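(* Let $(N,\mu,\nu)$ be an intuitionistic fuzzy normed space, let $(u_k)_{k\ge 1}$ be a sequence in $N$ and let $a\in N$. If $(u_k)$ is statistically Cesàro summable to $a$ and the sequence $\{k(u_k-u_{k-1})\}$ is q-bounded, then $(u_k)$ converges to $a$ in $(N,\mu,\nu)$.
   Context: An intuitionistic fuzzy normed space (IFNS) is a triple $(N,\mu,\nu)$ where $N$ is a real vector space with zero vector $\theta$ and $\mu,\nu:N\times\mathbb{R}\to[0,1]$ satisfy, for all $u,w\in N$ and $t,s\in\mathbb{R}$: (a) $\mu(u,t)=0$ for $t\le 0$; (b) $\mu(u,t)=1$ for all $t>0$ if and only if $u=\theta$; (c) $\mu(cu,t)=\mu(u,t/|c|)$ for all $t>0$ and real $c\ne 0$; (d) $\mu(u+w,t+s)\ge\min\{\mu(u,t),\mu(w,s)\}$; (e) $\lim_{t\to\infty}\mu(u,t)=1$, and $\lim_{t\to 0}\mu(u,t)=0$ if $u\neq\theta$; (f) $\nu(u,t)=1$ for $t\le 0$; (g) $\nu(u,t)=0$ for all $t>0$ if and only if $u=\theta$; (h) $\nu(cu,t)=\nu(u,t/|c|)$ for all $t>0$ and real $c\neq 0$; (i) $\max\{\nu(u,t),\nu(w,s)\}\ge\nu(u+w,t+s)$; (j) $\lim_{t\to\infty}\nu(u,t)=0$, and $\lim_{t\to0}\nu(u,t)=1$ if $u\ne\theta$. A sequence $(u_k)$ in $N$ is convergent to $a\in N$ if for every $\varepsilon>0$ and $t>0$ there is $k_0\in\mathbb{N}$ such that $\mu(u_k-a,t)>1-\varepsilon$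 and $\nu(u_k-a,t)<\varepsilon$ for all $k\ge k_0$. A sequence $(v_k)$ in $N$ is statistically convergent to $a\in N$ with respect to $(\mu,\nu)$ if for every $\varepsilon>0$ and $t>0$, $\lim_{n\to\infty}\frac1n\left|\{k\le n:\mu(v_k-a,t)\le 1-\varepsilon\text{ or }\nu(v_k-a,t)\ge\varepsilon\}\right|=0$. $(u_k)$ is statistically Cesàro summable to $a$ if the sequence $(\sigma_k)$ of Cesàro means $\sigma_k=\frac1k\sum_{j=1}^k u_j$ is statistically convergent to $a$. A sequence $(v_k)$ in $N$ is q-bounded if $\lim_{t\to\infty}\inf_{k}\mu(v_k,t)=1$ and $\lim_{t\to\infty}\sup_{k}\nu(v_k,t)=0$. In $\{k(u_k-u_{k-1})\}$ the convention $u_0=\theta$ is used. *)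

(* Defs.v *)
From HB Require Import structures.
From mathcomp Require Import all_boot all_order all_algebra.
From mathcomp Require Import all_classical all_reals all_analysis.

Set Implicit Arguments.
Unset Strict Implicit.
Unset Printing Implicit Defensive.

Import Order.TTheory GRing.Theory Num.Theory.
Import numFieldNormedType.Exports.

Local Open Scope classical_set_scope.
Local Open Scope ring_scope.

Record is_ifns (R : realType) (N : lmodType R) (mu nu : N -> R -> R) : Prop :=
  IsIfns {
    ifns_mu_range : forall u t, 0 <= mu u t <= 1;
    ifns_nu_range : forall u t, 0 <= nu u t <= 1;
    ifns_mu_npos : forall u t, t <= 0 -> mu u t = 0;
    ifns_mu_eq1 : forall u, (forall t, 0 < t -> mu u t = 1) <-> u = 0;
    ifns_muZ : forall u c t, 0 < t -> c != 0 -> mu (c *: u) t = mu u (t / `|c|);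
    ifns_muD : forall u w t s,
      Num.min (mu u t) (mu w s) <= mu (u + w) (t + s);
    ifns_mu_cvgy : forall u, mu u t @[t --> +oo] --> (1 : R);
    ifns_mu_cvg0 : forall u, u != 0 -> mu u t @[t --> (0 : R)^'] --> (0 : R);
    ifns_nu_npos : forall u t, t <= 0 -> nu u t = 1;
    ifns_nu_eq0 : forall u, (forall t, 0 < t -> nu u t = 0) <-> u = 0;
    ifns_nuZ : forall u c t, 0 < t -> c != 0 -> nu (c *: u) t = nu u (t / `|c|);
    ifns_nuD : forall u w t s,
      nu (u + w) (t + s) <= Num.max (nu u t) (nu w s);
    ifns_nu_cvgy : forall u, nu u t @[t --> +oo] --> (0 : R);
    ifns_nu_cvg0 : forall u, u != 0 -> nu u t @[t --> (0 : R)^'] --> (1 : R)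
  }.

(* A sequence (v_k)_{k >= 1} is a function v : nat -> N whose value at 0 is
   junk: none of the notions below depends on v 0. *)

Definition ifn_cvg (R : realType) (N : lmodType R) (mu nu : N -> R -> R)
    (v : nat -> N) (a : N) : Prop :=
  forall eps t : R, 0 < eps -> 0 < t ->
    exists k0 : nat, forall k : nat, (1 <= k)%N -> (k0 <= k)%N ->
      1 - eps < mu (v k - a) t /\ nu (v k - a) t < eps.

Definition ifn_stat_cvg (R : realType) (N : lmodType R) (mu nu : N -> R -> R)
    (v : nat -> N) (a : N) : Prop :=
  forall eps t : R, 0 < eps -> 0 < t ->
    n%:R^-1 * (count (fun k => (mu (v k - a) t <= 1 - eps)
                               || (eps <= nu (v k - a) t))
                     (index_iota 1 n.+1))%:R @[n --> \oo] --> (0 : R).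

Definition cesaro_mean (R : realType) (N : lmodType R) (u : nat -> N)
    (k : nat) : N :=
  k%:R^-1 *: \sum_(1 <= j < k.+1) u j.

Definition ifn_stat_cesaro (R : realType) (N : lmodType R)
    (mu nu : N -> R -> R) (u : nat -> N) (a : N) : Prop :=
  ifn_stat_cvg mu nu (cesaro_mean u) a.

Definition ifn_qbounded (R : realType) (N : lmodType R) (mu nu : N -> R -> R)
    (v : nat -> N) : Prop :=
  inf [set mu (v k) t | k in [set k | (1 <= k)%N]] @[t --> +oo] --> (1 : R) /\
  sup [set nu (v k) t | k in [set k | (1 <= k)%N]] @[t --> +oo] --> (0 : R).

(* k (u_k - u_{k-1}), where the term u_0 occurring at k = 1 is read as 0. *)
Definition weighted_diff (R : realType) (N : lmodType R) (u : nat -> N)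
    (k : nat) : N :=
  k%:R *: (u k - (if k == 1%N then 0 else u k.-1)).

(* Main.v *)
(* For each level eps, p(x) = inf {t > 0 : mu(x,t) > 1 - eps, nu(x,t) < eps} is a
   seminorm on N, because the triangle axioms use min and max; convergence and
   q-boundedness are convergence and boundedness for all these seminorms.  It
   remains to prove the Tauberian theorem for one seminorm.  If k (v_{k+1} - v_k)
   is bounded by M then so is v_k - s_k, hence so is k (s_{k+1} - s_k) for the
   means s_k.  A sequence with this property moves little on [(1 - 1/q) n, n],
   and a set of density zero cannot contain such a block, so s_k converges
   ordinarily.  Finally v_n is compared with the average of v over the block
   (n, n + n/q], which is a combination of s_n and s_{n + n/q}. *)
Require Import Defs.
From mathcomp Require Import all_boot all_order all_algebra.
From mathcomp Require Import all_classical all_reals all_analysis.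
From mathcomp Require Import zify ring lra.

Set Implicit Arguments.
Unset Strict Implicit.
Unset Printing Implicit Defensive.

Import Order.TTheory GRing.Theory Num.Theory.
Import numFieldNormedType.Exports.

Local Open Scope classical_set_scope.
Local Open Scope ring_scope.

(** * Arithmetic and counting on blocks *)

(** Here [n < (n %/ q + 1) * q] and [n %/ q] is at least 1. So a block of length [n %/ q] fills more
    than the fraction 1/(2q) of [1, n]. *)
Lemma divn_gt_half (n q : nat) : (0 < q <= n)%N -> (n < 2 * (n %/ q) * q)%N.
Proof.
move=> /andP[q0 qn].
have h1 : (0 < n %/ q)%N by rewrite divn_gt0.
have := ltn_ceil n q0; nia.
Qed.

Lemma count_block (P : pred nat) (m n : nat) : (m <= n)%N ->
  (forall k, (m < k <= n)%N -> P k) ->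
  (n - m <= count P (index_iota 1 n.+1))%N.
Proof.
move=> mn hP.
have -> : index_iota 1 n.+1 = index_iota 1 m.+1 ++ iota m.+1 (n - m).
  by rewrite /index_iota !subn1 /= -{1}(subnKC mn) iotaD add1n.
rewrite count_cat (_ : count P (iota _ _) = n - m)%N ?leq_addl//.
have : all P (iota m.+1 (n - m)).
  by apply/allP => k; rewrite mem_iota => hk; apply: hP; lia.
by rewrite all_count size_iota => /eqP.
Qed.

(** * The Tauberian theorem for a single seminorm *)

Section Tauberian.
Variables (R : realType) (N : lmodType R) (p : N -> R).
Hypothesis p_ge0 : forall x, 0 <= p x.
Hypothesis pD : forall x y, p (x + y) <= p x + p y.
Hypothesis pZ : forall c x, p (c *: x) <= `|c| * p x.

(** Forward differences from [k = 1] on keep the junk value [w 0] out. *)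
Definition slow (w : nat -> N) (M : R) : Prop :=
  forall k, (0 < k)%N -> k%:R * p (w k.+1 - w k) <= M.

Definition null (w : nat -> N) : Prop :=
  forall t : R, 0 < t -> exists n0, forall n, (n0 <= n)%N -> p (w n) < t.

Lemma seminorm0 : p 0 = 0.
Proof.
apply/eqP; rewrite eq_le p_ge0 andbT -[X in p X](scale0r 0).
by rewrite (le_trans (pZ _ _))// normr0 mul0r.
Qed.

Lemma seminormN x : p (- x) = p x.
Proof.
have le y : p (- y) <= p y.
  by rewrite -scaleN1r (le_trans (pZ _ _))// normrN1 mul1r.
by apply/eqP; rewrite eq_le le -{1}[x]opprK le.
Qed.

(** [pZ] is only an inequality; applying it to the inverse scalar as well gives equality. *)
Lemma seminormZn (n : nat) x : p (n%:R *: x) = n%:R * p x.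
Proof.
case: n => [|n]; first by rewrite scale0r mul0r seminorm0.
apply/eqP; rewrite eq_le; apply/andP; split.
  by rewrite (le_trans (pZ _ _))// ger0_norm.
rewrite -ler_pdivlMl ?ltr0n//.
rewrite -{1}[x](@scalerK _ _ n.+1%:R) ?unitfE ?pnatr_eq0//.
by rewrite (le_trans (pZ _ _))// ger0_norm// invr_ge0.
Qed.

Lemma seminormB x y : p (x - y) <= p x + p y.
Proof. by rewrite -(seminormN y) pD. Qed.

Lemma seminorm_sum (I : Type) (r : seq I) (P : pred I) (F : I -> N) :
  p (\sum_(i <- r | P i) F i) <= \sum_(i <- r | P i) p (F i).
Proof.
elim/big_ind2: _ => [|x a y b ha hb|//]; first by rewrite seminorm0.
by rewrite (le_trans (pD _ _))// lerD.
Qed.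

Lemma slow_ge0 w M : slow w M -> 0 <= M.
Proof. by move/(_ 1%N isT); apply: le_trans; rewrite mulr_ge0. Qed.

(** Telescoping: each of the n - m differences starts at an index at least m, so m times its size is
    at most M. *)
Lemma slow_block w M m n : slow w M -> (0 < m <= n)%N ->
  m%:R * p (w n - w m) <= M * (n - m)%:R.
Proof.
move=> sw /andP[m0 mn]; rewrite -(subnKC mn) addKn.
elim: (n - m)%N => [|d IH]; first by rewrite addn0 subrr seminorm0 !mulr0.
rewrite addnS.
have -> : w (m + d).+1 - w m = (w (m + d).+1 - w (m + d)%N) + (w (m + d)%N - w m).
  by rewrite addrA subrK.
apply: (@le_trans _ _ (m%:R * (p (w (m + d).+1 - w (m + d)%N) + p (w (m + d)%N - w m)))).
  by rewrite ler_wpM2l.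
rewrite mulrDr -natr1 mulrDr mulr1 addrC lerD//.
apply: le_trans (sw (m + d)%N _); last by rewrite addn_gt0 m0.
by rewrite ler_wpM2r// ler_nat leq_addr.
Qed.

Lemma cesaro_meanK (v : nat -> N) n : (0 < n)%N ->
  n%:R *: cesaro_mean v n = \sum_(1 <= j < n.+1) v j.
Proof. by move=> n0; rewrite /cesaro_mean scalerKV ?unitfE ?pnatr_eq0 -?lt0n. Qed.

(** Abel summation: n (v_n - s_n) is the sum of j (v_{j+1} - v_j) over 1 <= j < n. *)
Lemma slow_cesaro_gap v M n : slow v M -> (0 < n)%N ->
  p (v n - cesaro_mean v n) <= M.
Proof.
move=> sv; case: n => // n _.
have M0 := slow_ge0 sv.
rewrite -(@ler_pM2l _ n.+1%:R) ?ltr0n// -seminormZn scalerBr cesaro_meanK//.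
(* The n + 1 terms of v leave n differences, so the induction carries n M. *)
suff : p (n.+1%:R *: v n.+1 - \sum_(1 <= j < n.+2) v j) <= n%:R * M.
  by move/le_trans; apply; rewrite ler_wpM2r// ler_nat.
elim: n => [|n IH]; first by rewrite big_nat1 scale1r subrr seminorm0 mul0r.
have -> : n.+2%:R *: v n.+2 - \sum_(1 <= j < n.+3) v j =
    n.+1%:R *: (v n.+2 - v n.+1) + (n.+1%:R *: v n.+1 - \sum_(1 <= j < n.+2) v j).
  rewrite big_nat_recr//= scalerBr addrA subrK.
  by rewrite -[n.+2%:R]natr1 scalerDl scale1r opprD addrACA subrr addr0.
rewrite (le_trans (pD _ _))// -[X in _ <= X * M]natr1 mulrDl mul1r addrC lerD//.
by rewrite seminormZn sv.
Qed.

(** The identity k (s_{k+1} - s_k) = v_{k+1} - s_{k+1} reduces this to the gap bound. *)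
Lemma slow_cesaro v M : slow v M -> slow (cesaro_mean v) M.
Proof.
move=> sv k k0; rewrite -seminormZn.
suff -> : k%:R *: (cesaro_mean v k.+1 - cesaro_mean v k) =
    v k.+1 - cesaro_mean v k.+1 by exact: slow_cesaro_gap.
rewrite scalerBr cesaro_meanK//; apply/eqP; rewrite subr_eq addrAC; apply/eqP.
rewrite [v _ + _]addrC -big_nat_recr//= -cesaro_meanK//.
by rewrite -natr1 scalerDl scale1r addrK.
Qed.

Lemma slow_stat_null w M : slow w M ->
  (forall t d : R, 0 < t -> 0 < d -> exists n0, forall n, (n0 <= n)%N ->
     (count (fun k => t < p (w k)) (index_iota 1 n.+1))%:R <= d * n%:R) ->
  null w.
Proof.
move=> sw st t t0; have M0 := slow_ge0 sw.
(* [q'.+1] exceeds M / (t/2); the extra 1 in [q] pays for the block, as m > n - h >= h (q - 1). *)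
have := truncnS_gt (M / (t / 2)); set q' := Num.truncn _ => hq; set q := q'.+2.
have q0 : 0 < (2 * q)%:R :> R by rewrite ltr0n.
(* With tolerance 1/(2q), at most n/(2q) < h indices up to n are bad, too few to fill (n - h, n]. *)
have [n0 hn0] := st (t / 2) (2 * q)%:R^-1 ltac:(lra) ltac:(by rewrite invr_gt0).
exists (maxn n0 q) => n; rewrite geq_max => /andP[n0n qn].
have := @divn_gt_half n q qn; set h := (n %/ q)%N => hh.
have hqn : (h * q <= n)%N by exact: leq_trunc_div.
have [m /andP[m1 m2] hm] : exists2 m, (n - h < m <= n)%N & p (w m) <= t / 2.
  apply: contrapT => abs.
  have /count_block : forall k, (n - h < k <= n)%N -> t / 2 < p (w k).
    by move=> k hk; rewrite ltNge; apply/negP => le; apply: abs; exists k.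
  move=> /(_ (leq_subr _ _)); rewrite subKn ?leq_div// => /(leq_mul (leqnn (2 * q))).
  have := hn0 n n0n; rewrite ler_pdivlMl// -natrM ler_nat; lia.
have h0 : (0 < h)%N by lia.
have blk := @slow_block w M m n sw ltac:(lia).
have : p (w n - w m) < t / 2.
  rewrite -(@ltr_pM2l _ (h * q'.+1)%:R) ?ltr0n ?muln_gt0 ?h0//.
  apply: (@le_lt_trans _ _ (M * h%:R)).
    apply: le_trans (le_trans blk _); last first.
      by rewrite ler_wpM2l// ler_nat; lia.
    by rewrite ler_wpM2r// ler_nat /q in hqn *; lia.
  by rewrite natrM mulrC -mulrA ltr_pM2l ?ltr0n// -ltr_pdivrMr//; lra.
have := pD (w n - w m) (w m); rewrite subrK; lra.
Qed.

Lemma slow_null v M : slow v M -> null (cesaro_mean v) -> null v.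
Proof.
move=> sv cv t t0; have M0 := slow_ge0 sv.
have := truncnS_gt (M / (t / 2)); set q' := Num.truncn _ => hq; set q := q'.+1 in hq *.
(* The two means will contribute (n + h) t' + n t', and 2 n + h <= (4 q + 1) h. *)
pose t' := t / 2 / (4 * q + 1)%:R.
have q0 : 0 < (4 * q + 1)%:R :> R by rewrite ltr0n addn1.
have t'0 : 0 < t' by rewrite /t' !divr_gt0.
have [n0 hn0] := cv t' t'0.
exists (maxn n0 q) => n; rewrite geq_max => /andP[n0n qn].
have := @divn_gt_half n q qn; set h := (n %/ q)%N => hh.
have hqn : (h * q <= n)%N by exact: leq_trunc_div.
have h0 : (0 < h)%N by lia.
have npos : (0 < n)%N by lia.
have n0r : 0 < n%:R :> R by rewrite ltr0n.
have decomp : h%:R *: v n = \sum_(n.+1 <= j < (n + h).+1) (v n - v j) +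
    ((n + h)%:R *: cesaro_mean v (n + h)%N - n%:R *: cesaro_mean v n).
  rewrite !cesaro_meanK ?addn_gt0 ?npos// sumrB sumr_const_nat subSS addKn scaler_nat.
  rewrite (@big_cat_nat _ _ _ n.+1 1 (n + h).+1) ?ltnS ?leq_addr//=.
  by rewrite [\sum_(1 <= j < n.+1) v j + _]addrC addrK subrK.
have hS m : (n <= m)%N -> p (m%:R *: cesaro_mean v m) <= m%:R * t'.
  by move=> nm; rewrite seminormZn ler_wpM2l// ltW// hn0// (leq_trans n0n).
(* Each v_n - v_j costs at most M (j - n) / n <= M h / n, which is below t/2 because h q <= n. *)
have hsum : p (\sum_(n.+1 <= j < (n + h).+1) (v n - v j)) <= h%:R * (M * h%:R / n%:R).
  apply: le_trans (seminorm_sum _ _ _) _.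
  rewrite mulr_natl -[X in _ *+ X](addKn n) -subSS -sumr_const_nat.
  apply: ler_sum_nat => j /andP[j1 j2].
  rewrite -seminormN opprB ler_pdivlMr// mulrC.
  apply: le_trans (slow_block sv _) _; first by lia.
  by rewrite ler_wpM2l// ler_nat; lia.
have hM : M * h%:R / n%:R < t / 2.
  rewrite ltr_pdivrMr//; apply: (@lt_le_trans _ _ (t / 2 * (h * q)%:R)).
    by rewrite natrM mulrA mulrAC ltr_pM2r ?ltr0n// mulrC -ltr_pdivrMr//; lra.
  by rewrite ler_wpM2l ?ler_nat//; lra.
rewrite -(@ltr_pM2l _ h%:R) ?ltr0n// -seminormZn decomp.
apply: le_lt_trans (pD _ _) _.
have := seminormB ((n + h)%:R *: cesaro_mean v (n + h)%N) (n%:R *: cesaro_mean v n).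
have := hS _ (leqnn n); have := hS _ (leq_addr h n).
have hM' : h%:R * (M * h%:R / n%:R) < h%:R * (t / 2) by rewrite ltr_pM2l ?ltr0n.
have : (n + h)%:R * t' + n%:R * t' <= h%:R * (t / 2).
  have -> : t / 2 = (4 * q + 1)%:R * t' by rewrite /t' mulrCA divff ?mulr1// gt_eqF.
  rewrite -mulrDl mulrA -natrD -natrM ler_pM2r// ler_nat; nia.
lra.
Qed.

Lemma seminorm_tauber v M : slow v M ->
  (forall t d : R, 0 < t -> 0 < d -> exists n0, forall n, (n0 <= n)%N ->
     (count (fun k => t < p (cesaro_mean v k)) (index_iota 1 n.+1))%:R <= d * n%:R) ->
  null v.
Proof.
by move=> sv st; apply: (slow_null sv); apply: slow_stat_null (slow_cesaro sv) st.
Qed.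

End Tauberian.

(** * The seminorm attached to a level [eps] *)

Section LevelSeminorm.
Variables (R : realType) (N : lmodType R) (mu nu : N -> R -> R).
Hypothesis hN : is_ifns mu nu.
Variable eps : R.
Hypothesis eps0 : 0 < eps.

(** For [eps > 1] the two inequalities hold at every t, so [0 < t] is what bounds the set below. *)
Definition level (x : N) : set R :=
  [set t | [/\ 0 < t, 1 - eps < mu x t & nu x t < eps]].

Definition level_seminorm (x : N) : R := inf (level x).

Lemma level0 t : 0 < t -> level 0 t.
Proof.
move=> t0; split => //.
  by rewrite ((ifns_mu_eq1 hN 0).2 erefl t t0) ltrBlDr ltrDl.
by rewrite ((ifns_nu_eq0 hN 0).2 erefl t t0).
Qed.

Lemma levelD x y t s : level x t -> level y s -> level (x + y) (t + s).
Proof.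
move=> [t0 mt nt] [s0 ms ns]; split; first exact: addr_gt0.
  by apply: lt_le_trans (ifns_muD hN _ _ _ _); rewrite lt_min mt.
by apply: le_lt_trans (ifns_nuD hN _ _ _ _) _; rewrite gt_max nt.
Qed.

Lemma levelZ c x t : c != 0 -> level x t -> level (c *: x) (`|c| * t).
Proof.
move=> c0 [t0 mt nt]; have nc0 : 0 < `|c| by rewrite normr_gt0.
by split; rewrite ?mulr_gt0// ?(ifns_muZ hN) ?(ifns_nuZ hN) ?mulr_gt0//
  mulrAC divff ?mul1r// gt_eqF.
Qed.

(** The limits at infinity supply an element; on an empty set [inf] would take a default value. *)
Lemma level_nonempty x : level x !=set0.
Proof.
have h1 : \forall t \near +oo, 1 - eps < mu x t.
  by apply: (cvgr_gt (1 : R) (ifns_mu_cvgy hN x)); rewrite ltrBlDr ltrDl.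
have h2 : \forall t \near +oo, nu x t < eps.
  exact: (cvgr_lt (0 : R) (ifns_nu_cvgy hN x)).
have h3 : \forall t \near +oo, (0 : R) < t by exact: nbhs_pinfty_gt.
by have [t [? [? ?]]] := filter_ex (filterI h1 (filterI h2 h3)); exists t.
Qed.

Lemma level_seminorm_le x t : level x t -> level_seminorm x <= t.
Proof. by move=> xt; apply: ge_inf xt; by exists 0 => s [/ltW]. Qed.

(** Some s < t lies in [level x], and adding the zero vector at level t - s raises s to t. *)
Lemma level_seminorm_lt x t : level_seminorm x < t -> level x t.
Proof.
move=> /(inf_lt (level_nonempty x))[s xs st].
by rewrite -(addr0 x) -(subrKC s t); apply: levelD xs (level0 _); rewrite subr_gt0.
Qed.

Lemma level_seminorm_ge0 x : 0 <= level_seminorm x.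
Proof. by apply: lb_le_inf (level_nonempty x) _ => t [/ltW]. Qed.

Lemma level_seminormD x y :
  level_seminorm (x + y) <= level_seminorm x + level_seminorm y.
Proof.
apply/ler_addgt0Pr => e e0.
have -> : level_seminorm x + level_seminorm y + e =
  (level_seminorm x + e / 2) + (level_seminorm y + e / 2) by field.
by apply: level_seminorm_le; apply: levelD; apply: level_seminorm_lt; lra.
Qed.

Lemma level_seminormZ c x : level_seminorm (c *: x) <= `|c| * level_seminorm x.
Proof.
(* The homogeneity axioms exclude [c = 0]; there every positive e lies in [level 0]. *)
have [->|c0] := eqVneq c 0.
  rewrite scale0r normr0 mul0r; apply/ler_addgt0Pr => e e0.
  by rewrite add0r; apply/level_seminorm_le/level0.
have nc0 : 0 < `|c| by rewrite normr_gt0.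
rewrite -ler_pdivrMl//; apply: lb_le_inf (level_nonempty x) _ => t xt.
by rewrite ler_pdivrMl//; apply/level_seminorm_le/levelZ.
Qed.

Lemma qbounded_level (v : nat -> N) : ifn_qbounded mu nu v ->
  exists M, forall k, (0 < k)%N -> level (v k) M.
Proof.
move=> [hmu hnu].
have h1 : \forall t \near +oo,
    1 - eps < inf [set mu (v k) t | k in [set k | (1 <= k)%N]].
  by apply: (cvgr_gt (1 : R) hmu); rewrite ltrBlDr ltrDl.
have h2 : \forall t \near +oo,
    sup [set nu (v k) t | k in [set k | (1 <= k)%N]] < eps.
  exact: (cvgr_lt (0 : R) hnu).
have h3 : \forall t \near +oo, (0 : R) < t by exact: nbhs_pinfty_gt.
have [M [/= hi [hs M0]]] := filter_ex (filterI h1 (filterI h2 h3)).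
exists M => k k0; split => //.
  (* Both value sets lie in [0, 1], so [inf] and [sup] really bound them. *)
  apply: lt_le_trans hi _; apply: ge_inf; last by exists k.
  by exists 0 => _ [j _ <-]; case/andP: (ifns_mu_range hN (v j) M).
apply: le_lt_trans hs; apply: ub_le_sup; last by exists k.
by exists 1 => _ [j _ <-]; case/andP: (ifns_nu_range hN (v j) M).
Qed.

Lemma stat_cvg_level (w : nat -> N) a : ifn_stat_cvg mu nu w a ->
  forall t d : R, 0 < t -> 0 < d -> exists n0, forall n, (n0 <= n)%N ->
    (count (fun k => t < level_seminorm (w k - a)) (index_iota 1 n.+1))%:R
      <= d * n%:R.
Proof.
move=> hw t d t0 d0.
have [n0 _ hn0] : \forall n \near \oo, _ < d := cvgr_lt (0 : R) (hw eps t eps0 t0) d d0.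
(* The successor makes n positive, so the factor 1/n can be cleared. *)
exists n0.+1 => n n0n.
have n0r : 0 < n%:R :> R by rewrite ltr0n (leq_ltn_trans _ n0n).
have := hn0 n (ltnW n0n); rewrite /= ltr_pdivrMl// mulrC => /ltW; apply: le_trans.
(* By contraposition: an index failing both counted conditions has t in its level set, hence
   seminorm at most t. *)
rewrite ler_nat; apply: sub_count => k /=; rewrite ltNge; apply: contraNT.
rewrite negb_or -!ltNge => /andP[hm hn].
exact: level_seminorm_le.
Qed.

End LevelSeminorm.

(** * Transfer to the fuzzy norm *)

(** At [k = 0] the mean is 0 by convention, hence the positivity assumption. *)
Lemma cesaro_meanB (R : realType) (N : lmodType R) (u : nat -> N) (a : N) k :
  (0 < k)%N -> cesaro_mean (fun j => u j - a) k = cesaro_mean u k - a.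
Proof.
move=> k0; rewrite /cesaro_mean sumrB sumr_const_nat subn1 /= scalerBr.
by rewrite -[a *+ k]scaler_nat scalerK ?unitfE ?pnatr_eq0 -?lt0n.
Qed.

Theorem theorem2p7 (R : realType) (N : lmodType R) (mu nu : N -> R -> R)
    (hN : is_ifns mu nu) (u : nat -> N) (a : N)
    (hsum : ifn_stat_cesaro mu nu u a)
    (hbdd : ifn_qbounded mu nu (weighted_diff u)) :
  ifn_cvg mu nu u a.
Proof.
move=> eps t eps0 t0.
pose p := level_seminorm mu nu eps.
have p_ge0 : forall x, 0 <= p x := level_seminorm_ge0 hN eps0.
have pD : forall x y, p (x + y) <= p x + p y := level_seminormD hN eps0.
have pZ : forall c x, p (c *: x) <= `|c| * p x := level_seminormZ hN eps0.
have [M hM] := qbounded_level hN eps0 hbdd.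
have sv : slow p (fun k => u k - a) M.
  move=> k k0; rewrite opprB addrA subrK.
  apply: (@le_trans _ _ (k.+1%:R * p (u k.+1 - u k))).
    by rewrite ler_wpM2r// ler_nat.
  rewrite -(seminormZn p_ge0 pZ); apply: level_seminorm_le.
  (* The index k + 1 is at least 2, so the convention for u_0 does not intervene. *)
  by have := hM k.+1 isT; rewrite /weighted_diff eqSS -[k == 0%N]negbK -lt0n k0.
have [|n0 hn0] := seminorm_tauber p_ge0 pD pZ sv _ t0.
  move=> s d s0 d0; have [n0 hn0] := stat_cvg_level eps0 hsum s0 d0.
  exists n0 => n /hn0.
  suff /eq_in_count -> : {in index_iota 1 n.+1, forall k,
    (s < level_seminorm mu nu eps (cesaro_mean u k - a)) =
    (s < p (cesaro_mean (fun j => u j - a) k))} by [].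
  by move=> k; rewrite mem_index_iota => /andP[k1 _]; rewrite cesaro_meanB.
(* Strict smallness of the seminorm puts [t] itself in the level set, which contains both required
   inequalities. *)
exists n0 => k _ /hn0 /(level_seminorm_lt hN eps0)[_ ? ?].
by split.
Qed.
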